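(* Let $(M_n)_{n\ge1}$ be some sequence of $d\times d$ stochastic matrices. Assume that there exist constants $\gamma>0$ and $\rho\ge1$ such that for every $n\ge1$ and $i,j$ in $\{1,\dots,d\}$, $M_n(i,i)\ge\gamma$ and $M_n(i,j)\le\rho M_n(j,i)$. Then the sequence $(M_n\cdots M_1)_{n\ge1}$ has a finite variation, so it converges to some stochastic matrix $L$. Moreover, the series $\sum_nM_n(i,j)$ and $\sum_nM_n(j,i)$ converge whenever the rows of $L$ with indexes $i$ and $j$ are different.
   Context: A stochastic matrix is a real matrix with non-negative entries whose rows each sum to $1$. A sequence $(x_n)$ in a normed vector space $(E,\|\cdot\|)$ has a finite variation if the series $\sum_n\|x_{n+1}-x_n\|$ converges. *)

(* Defs.v *)
From mathcomp Require Export all_boot all_order all_algebra.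
From mathcomp Require Export all_classical all_reals all_analysis.
Export Order.TTheory GRing.Theory Num.Theory.
Export numFieldNormedType.Exports.

Set Implicit Arguments.
Unset Strict Implicit.
Unset Printing Implicit Defensive.

Local Open Scope classical_set_scope.
Local Open Scope ring_scope.

Definition stochastic (R : realType) (d : nat) (A : 'M[R]_d) : Prop :=
  (forall i j, 0 <= A i j) /\ (forall i, \sum_j A i j = 1).

Definition finite_variation (R : realType) (E : normedModType R)
    (x : nat -> E) : Prop :=
  cvgn (series (fun n => `|x n.+1 - x n|)).

(* [lprodmx M n] is [M n *m ... *m M 1]; the value [M 0] is never used. *)
Fixpoint lprodmx (R : realType) (d : nat) (M : nat -> 'M[R]_d) (n : nat)
    : 'M[R]_d :=
  if n is n'.+1 then M n'.+1 *m lprodmx M n' else 1%:M.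

(* Main.v *)
From mathcomp Require Import perm lra.
Require Import Defs.

Set Implicit Arguments.
Unset Strict Implicit.
Unset Printing Implicit Defensive.

Local Open Scope classical_set_scope.
Local Open Scope ring_scope.

(** Fix a column [l] and let [x_n] be the [l]-th column of [M_n ... M_1], so
    that [x_(n+1) = M_(n+1) x_n].  Everything follows from the summability over
    [n] of the flow [\sum_(i, j) M_(n+1)(i,j) |x_n(i) - x_n(j)|]: this sum
    dominates [|x_(n+1) - x_n|], hence the finite variation and the limit [L];
    and if the limits of [x_n(i)] and [x_n(j)] differ, the factor
    [|x_n(i) - x_n(j)|] is eventually bounded away from 0, so that
    [\sum_n M_n(i,j)] converges.

    The flow is controlled by a Lyapunov argument.  Give the rank [l] the weight
    [theta ^+ l], with [theta] small, and consider the sums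
    [\sum_i theta ^+ s i * x i] over all rankings [s] of the indices.
    Lemma [weighted_sum_gain] says that for every ranking [s], the [s]-weighted
    sum of [M x] exceeds the [r]-weighted sum of [x] by at least a fixed multiple
    of the flow, where [r] is the ranking that sorts [x] increasingly.  Iterating
    this backwards from time [N] to time 0 adds up the flows
    ([total_flow_bounded]), and all the weighted sums lie between 0 and [d]
    because the columns have entries between 0 and 1.

    Writing a sorted [x] as a nonnegative combination of the indicators of its
    upper level sets ([sorted_layers]) reduces the one-step inequality to such an
    indicator, that is, to a cut of the index set into a low part and a high
    part ([cut_gain]).  If [s] ranks the low part before the high part, then the
    mass sent up is weighted at least [1 / theta] times as much as the mass
    sent down, while the two masses are comparable by the hypothesis
    [M(i,j) <= rho M(j,i)].  Otherwise some high index has a low rank under [s],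
    hence a heavy weight, and the part [gamma] that its diagonal entry keeps in
    place outweighs all the high ranks together. *)

(** * Flow across a single cut *)

Definition flow (R : numDomainType) (d : nat) (M : 'M[R]_d) (x : 'I_d -> R) : R :=
  \sum_i \sum_j M i j * `|x i - x j|.

Lemma flow_ge0 (R : numDomainType) (d : nat) (M : 'M[R]_d) (x : 'I_d -> R) :
  (forall i j, 0 <= M i j) -> 0 <= flow M x.
Proof.
by move=> M0; rewrite sumr_ge0 // => i _; rewrite sumr_ge0 // => j _;
  rewrite mulr_ge0.
Qed.

Lemma row_flow_le (R : numDomainType) (d : nat) (M : 'M[R]_d) (x : 'I_d -> R) i :
  (forall i j, 0 <= M i j) -> \sum_j M i j * `|x i - x j| <= flow M x.
Proof.
move=> M0; rewrite /flow [leRHS](bigD1 i) //= lerDl sumr_ge0 // => a _.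
by rewrite sumr_ge0 // => b _; rewrite mulr_ge0.
Qed.

Lemma normr_boolB (R : numDomainType) (b c : bool) :
  `|b%:R - c%:R| = (b (+) c)%:R :> R.
Proof.
by case: b; case: c; rewrite ?subrr ?subr0 ?sub0r ?normrN ?normr0 ?normr1.
Qed.

(** The Lyapunov inequality for the indicator of the high part
    [{i | k < r i}] of a cut.  The two smallness conditions on [theta] serve the
    two cases: [rho * theta <= 1/2] when [s] respects the cut, and
    [d * theta <= gamma / 2] when it does not; likewise for the conditions on
    [eta].  The factor [theta ^+ d] is a lower bound of all the weights. *)
Lemma cut_gain (R : realFieldType) (d : nat) (M : 'M[R]_d)
    (gamma rho theta eta : R)
    (M0 : forall i j, 0 <= M i j) (M1 : forall i, \sum_j M i j = 1)
    (gamma0 : 0 <= gamma) (hdiag : forall i, gamma <= M i i)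
    (rho0 : 0 <= rho) (hrev : forall i j, M i j <= rho * M j i)
    (theta0 : 0 < theta) (theta1 : theta <= 1)
    (thetag : d%:R * theta <= gamma / 2) (thetar : rho * theta <= 2^-1)
    (eta0 : 0 <= eta) (etar : eta * (1 + rho) <= 2^-1)
    (etag : eta * d%:R <= gamma / 2)
    (s r : 'S_d) (k : 'I_d) :
  \sum_i theta ^+ r i * (k < r i)%:R
    + theta ^+ d * eta * flow M (fun i => (k < r i)%:R)
  <= \sum_i theta ^+ s i * \sum_j M i j * (k < r j)%:R.
Proof.
pose B i := (k < r i)%N.
have theta_le m n : (m <= n)%N -> theta ^+ n <= theta ^+ m.
  by move=> mn; rewrite ler_wiXn2l // ltW.
have theta_ge0 n : 0 <= theta ^+ n by rewrite exprn_ge0 // ltW.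
have tk0 : 0 < theta ^+ k by rewrite exprn_gt0.
have td : theta ^+ d <= theta ^+ k by rewrite theta_le // ltnW.
set F := flow _ _.
have F0 : 0 <= F by exact: flow_ge0.
have [sB|sB] := altP (@forallP _ (fun i => B i ==> (k < s i)%N)); last first.
  (* The diagonal entry at the misplaced index [i0] beats every other term. *)
  rewrite negb_forall in sB; case/existsP: sB => i0.
  rewrite negb_imply -leqNgt => /andP[Bi0 si0].
  have tail : \sum_i theta ^+ r i * (B i)%:R <= d%:R * (theta * theta ^+ k).
    rewrite mulr_natl -[X in _ *+ X]card_ord -sumr_const ler_sum // => i _.
    rewrite /B; case: ltnP => ki; last by rewrite mulr0 mulr_ge0 ?ltW.
    by rewrite mulr1 -exprS theta_le.
  have Fd : F <= d%:R.
    rewrite -[X in X%:R]card_ord -sumr_const ler_sum // => i _.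
    rewrite -[leRHS](M1 i) ler_sum // => j _; rewrite ler_piMr //.
    by rewrite normr_boolB lern1 leq_b1.
  have main : gamma * theta ^+ k
      <= \sum_i theta ^+ s i * \sum_j M i j * (B j)%:R.
    rewrite (bigD1 i0) //= -[leLHS]addr0 lerD //.
      rewrite mulrC ler_pM ?theta_le ?(ltW tk0) // (le_trans (hdiag i0)) //.
      rewrite (bigD1 i0) //= Bi0 mulr1 lerDl sumr_ge0 // => j _.
      by rewrite mulr_ge0.
    rewrite sumr_ge0 // => i _; rewrite mulr_ge0 ?theta_ge0 //.
    by rewrite sumr_ge0 // => j _; rewrite mulr_ge0.
  apply: le_trans main.
  have : theta ^+ d * eta * F <= theta ^+ k * (gamma / 2).
    rewrite -mulrA ler_pM ?theta_ge0 // ?mulr_ge0 //.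
    by apply: le_trans etag; rewrite ler_wpM2l.
  have : d%:R * (theta * theta ^+ k) <= gamma / 2 * theta ^+ k.
    by rewrite mulrA ler_wpM2r // ltW.
  by move: tail; rewrite /B; lra.
have {}sB i : B i -> (k < s i)%N by move=> Bi; have := sB i; rewrite Bi.
(* The set [B] has as many elements as there are ranks above [k]. *)
have BE i : B i = (k < s i)%N.
  have : [set i | B i]%SET == [set i | (k < s i)%N]%SET.
    rewrite eqEcard; apply/andP; split.
      by apply/fintype.subsetP => j; rewrite !inE; apply: sB.
    have cardE (t : 'S_d) :
        #|[set i | (k < t i)%N]%SET| = #|[set l : 'I_d | (k < l)%N]%SET|.
      rewrite -[RHS](card_preimset _ (@perm_inj _ t)).
      by apply: eq_card => j; rewrite !inE.
    by rewrite !cardE.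
  by move=> /eqP/finset.setP/(_ i); rewrite !inE.
(* The masses that [M] moves up and down across the cut. *)
pose f := \sum_i \sum_j M i j * (~~ B i && B j)%:R.
pose g := \sum_i \sum_j M i j * (B i && ~~ B j)%:R.
have FE : F = f + g.
  rewrite /F /flow /f /g -big_split; apply: eq_bigr => i _ /=.
  rewrite -big_split; apply: eq_bigr => j _ /=; rewrite -mulrDr.
  rewrite normr_boolB -natrD -/(B i) -/(B j).
  by case: (B i); case: (B j).
have gf : g <= rho * f.
  rewrite /g /f exchange_big mulr_sumr ler_sum // => i _.
  rewrite mulr_sumr ler_sum // => j _.
  by rewrite mulrA andbC ler_wpM2r.
have f0 : 0 <= f.
  by rewrite sumr_ge0 // => i _; rewrite sumr_ge0 // => j _; rewrite mulr_ge0.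
have rs : \sum_i theta ^+ r i * (k < r i)%:R = \sum_i theta ^+ s i * (B i)%:R.
  under [RHS]eq_bigr => i _ do rewrite BE.
  have E (t : 'S_d) : \sum_(l < d) theta ^+ l * (k < l)%:R =
      \sum_i theta ^+ t i * (k < t i)%:R :> R.
    by rewrite (reindex_inj (@perm_inj _ t)).
  by rewrite -!E.
(* Low indices weigh at least [theta ^+ k], high ones at most [theta ^+ k.+1]. *)
have main : \sum_i theta ^+ s i * (B i)%:R
      + (theta ^+ k * f - theta * theta ^+ k * g)
    <= \sum_i theta ^+ s i * \sum_j M i j * (B j)%:R.
  rewrite /f /g !mulr_sumr -sumrB -big_split ler_sum // => i _ /=.
  case: (boolP (B i)) => Bi /=.
    rewrite [X in _ * X - _]big1 ?mulr0; last by move=> j _; rewrite mulr0.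
    have -> : \sum_j M i j * (B j)%:R = 1 - \sum_j M i j * (~~ B j)%:R.
      rewrite -[X in X - _](M1 i) -sumrB; apply: eq_bigr => j _.
      by case: (B j); rewrite /= !(mulr1, mulr0) ?subr0 ?subrr.
    rewrite mulrBr sub0r lerD2l lerN2 ler_wpM2r //.
      by rewrite sumr_ge0 // => j _; rewrite mulr_ge0.
    by rewrite -exprS theta_le // -BE.
  rewrite mulr0 add0r [X in _ - _ * X]big1 ?mulr0 ?subr0; last first.
    by move=> j _; rewrite mulr0.
  rewrite ler_wpM2r ?theta_le //; last by rewrite leqNgt -BE.
  by rewrite sumr_ge0 // => j _; rewrite mulr_ge0.
apply: le_trans main; rewrite rs lerD2l.
apply: (@le_trans _ _ (theta ^+ k * (2^-1 * f))).
  rewrite -mulrA ler_pM ?theta_ge0 // ?mulr_ge0 //.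
  apply: (@le_trans _ _ (eta * (1 + rho) * f)); last by rewrite ler_wpM2r.
  by rewrite FE -mulrA ler_wpM2l // mulrDl mul1r lerD2l.
have : theta * theta ^+ k * g <= theta ^+ k * (2^-1 * f).
  rewrite [theta * _]mulrC -mulrA ler_wpM2l ?(ltW tk0) //.
  apply: (@le_trans _ _ (rho * theta * f)); last by rewrite ler_wpM2r.
  by rewrite [rho * _]mulrC -mulrA ler_wpM2l // ltW.
lra.
Qed.

(** * One step of the product *)

(** Sort the values [y_0 <= y_1 <= ...] of [x]: then [x0 = y_0], the [delta k]
    are the gaps [y_(k+1) - y_k], and [r i] is the rank of [x i]. *)
Lemma sorted_layers (R : realDomainType) (d : nat) (x : 'I_d -> R) :
  exists (r : 'S_d) (x0 : R) (delta : 'I_d -> R),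
    (forall k, 0 <= delta k) /\
    (forall i, x i = x0 + \sum_k delta k * (k < r i)%:R).
Proof.
pose t := [tuple x i | i < d].
have /tuple_permP[p tp] : perm_eq (sort <=%O t) t by rewrite perm_sort.
have sz : size (sort <=%O t) = d by rewrite size_sort size_tuple.
pose y k := nth 0 (sort <=%O t) k.
have y_mono k l : (k <= l)%N -> (l < d)%N -> y k <= y l.
  move=> kl ld; apply: (le_sorted_leq_nth 0 (sort_le_sorted _)) => //.
  - by rewrite inE sz (leq_ltn_trans kl).
  - by rewrite inE sz.
have yE (k : 'I_d) : y k = x (p k).
  rewrite /y; have -> : sort <=%O t = [tuple tnth t (p i) | i < d] by [].
  by rewrite -tnth_nth !tnth_mktuple.
(* The last index [k = d.-1] has no gap above it. *)
exists (p^-1)%g, (y 0), (fun k => if (k.+1 < d)%N then y k.+1 - y k else 0).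
split=> [k|i].
  by case: ifP => // kd; rewrite subr_ge0 y_mono.
rewrite -{1}(permKV p i) -yE; set l := (p^-1)%g i.
rewrite -[LHS](subrKC (y 0)); congr (_ + _).
rewrite -(telescope_sumr y (leq0n l)).
rewrite (big_nat_widen _ _ _ _ _ (ltnW (ltn_ord l))).
rewrite big_mkord big_mkcond; apply: eq_bigr => k _ /=.
case: ltnP => kl; last by rewrite mulr0.
by rewrite (leq_ltn_trans kl (ltn_ord l)) mulr1.
Qed.

Definition balanced (R : realType) (d : nat) (gamma rho : R) (M : 'M[R]_d) :=
  [/\ stochastic M, forall i, gamma <= M i i
    & forall i j, M i j <= rho * M j i].

(** Both sides are linear in [x], except for the flow, which is subadditive and
    stands on the side where this helps; so the inequality for the layers of [x]
    implies the inequality for [x]. *)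
Lemma weighted_sum_gain_powers (R : realType) (d : nat) (M : 'M[R]_d)
    (gamma rho theta eta : R)
    (hM : balanced gamma rho M) (gamma0 : 0 <= gamma) (rho0 : 0 <= rho)
    (theta0 : 0 < theta) (theta1 : theta <= 1)
    (thetag : d%:R * theta <= gamma / 2) (thetar : rho * theta <= 2^-1)
    (eta0 : 0 <= eta) (etar : eta * (1 + rho) <= 2^-1)
    (etag : eta * d%:R <= gamma / 2)
    (x : 'I_d -> R) (s : 'S_d) :
  exists r : 'S_d, \sum_i theta ^+ r i * x i + theta ^+ d * eta * flow M x
    <= \sum_i theta ^+ s i * \sum_j M i j * x j.
Proof.
have [[M0 M1] hdiag hrev] := hM.
have [r [x0 [delta [delta0 xE]]]] := sorted_layers x; exists r.
pose e k i : R := (k < r i)%:R.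
have lin (a : 'I_d -> R) : \sum_i a i * x i
    = x0 * (\sum_i a i) + \sum_k delta k * \sum_i a i * e k i.
  under [X in _ + X]eq_bigr => k _ do rewrite mulr_sumr.
  rewrite exchange_big mulr_sumr -big_split; apply: eq_bigr => i _ /=.
  rewrite xE mulrDr [x0 * _]mulrC; congr (_ + _).
  by rewrite mulr_sumr; apply: eq_bigr => k _; rewrite mulrCA.
have flow_le : flow M x <= \sum_k delta k * flow M (e k).
  rewrite /flow; under [leRHS]eq_bigr => k _ do rewrite mulr_sumr.
  rewrite [leRHS]exchange_big ler_sum // => i _.
  under [leRHS]eq_bigr => k _ do rewrite mulr_sumr.
  rewrite [leRHS]exchange_big ler_sum // => j _ /=.
  under [leRHS]eq_bigr => k _ do rewrite mulrCA.
  rewrite -mulr_sumr ler_wpM2l // !xE opprD addrACA subrr add0r -sumrB.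
  apply: le_trans (ler_norm_sum _ _ _) _; apply: ler_sum => k _.
  by rewrite -mulrBr normrM ger0_norm.
have rhsE : \sum_i theta ^+ s i * \sum_j M i j * x j
    = x0 * (\sum_i theta ^+ s i)
      + \sum_k delta k * \sum_i theta ^+ s i * \sum_j M i j * e k j.
  have E (y : 'I_d -> R) : \sum_i theta ^+ s i * \sum_j M i j * y j =
      \sum_j (\sum_i theta ^+ s i * M i j) * y j.
    under eq_bigr => i _ do rewrite mulr_sumr.
    rewrite exchange_big; apply: eq_bigr => j _.
    by rewrite mulr_suml; apply: eq_bigr => i _; rewrite mulrA.
  rewrite E lin exchange_big /=; congr (_ * _ + _); last first.
    by apply: eq_bigr => k _; rewrite E.
  by apply: eq_bigr => i _; rewrite -mulr_sumr M1 mulr1.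
(* The constant part [x0] contributes equally to both sides. *)
have perm_sum (t : 'S_d) : \sum_i theta ^+ t i = \sum_(l < d) theta ^+ l.
  by rewrite [RHS](reindex_inj (@perm_inj _ t)).
rewrite rhsE lin !perm_sum -addrA lerD2l.
apply: (@le_trans _ _ (\sum_k delta k *
    (\sum_i theta ^+ r i * e k i + theta ^+ d * eta * flow M (e k)))).
  under [leRHS]eq_bigr => k _ do
    rewrite mulrDr [delta k * (_ * flow _ _)]mulrCA.
  rewrite big_split -mulr_sumr lerD2l ler_wpM2l //.
  by rewrite mulr_ge0 // exprn_ge0 // ltW.
apply: ler_sum => k _; rewrite ler_wpM2l //.
exact: (@cut_gain _ _ _ gamma rho).
Qed.

(** The weights and the constant depend on [gamma], [rho] and [d] only, which is
    what allows iterating the inequality along a sequence of matrices. *)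
Lemma weighted_sum_gain (R : realType) (d : nat) (gamma rho : R)
    (gamma0 : 0 < gamma) (rho1 : 1 <= rho) :
  exists (w : 'I_d -> R) (c : R),
    [/\ forall i, 0 <= w i <= 1, 0 < c
      & forall M : 'M[R]_d, balanced gamma rho M ->
        forall (x : 'I_d -> R) (s : 'S_d), exists r : 'S_d,
          \sum_i w (r i) * x i + c * flow M x
            <= \sum_i w (s i) * \sum_j M i j * x j].
Proof.
(* Replacing [gamma] by [g <= 1] gives [theta <= 1] even when [d = 0]. *)
pose g := Num.min gamma 1.
have g0 : 0 < g by rewrite lt_min gamma0 ltr01.
have g1 : g <= 1 by rewrite ge_min lexx orbT.
have gg : g <= gamma by rewrite ge_min lexx.
have d0 : 0 <= d%:R :> R by [].
pose theta := g / (2 * d.+1%:R * rho).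
pose eta := g / (2 * d.+1%:R * (1 + rho)).
have dE : d.+1%:R = 1 + d%:R :> R by rewrite mulrS.
have theta0 : 0 < theta by rewrite divr_gt0 // !mulr_gt0 //; lra.
have eta0 : 0 < eta by rewrite divr_gt0 // !mulr_gt0 //; lra.
have theta1 : theta <= 1.
  by rewrite ler_pdivrMr ?dE; [nra|rewrite !mulr_gt0 //; lra].
exists (fun i => theta ^+ i), (theta ^+ d * eta); split.
- by move=> i; rewrite exprn_ge0 ?exprn_ile1 // ltW.
- by rewrite mulr_gt0 // exprn_gt0.
move=> M hM x s.
apply: (weighted_sum_gain_powers (gamma := gamma) (rho := rho)) => //; try lra.
- rewrite mulrA ler_pdivrMr ?dE; [|by rewrite !mulr_gt0 //; lra].
  have : g * d%:R <= gamma * ((1 + d%:R) * rho) by rewrite ler_pM //; nra.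
  by nra.
- rewrite mulrA ler_pdivrMr ?dE; [|by rewrite !mulr_gt0 //; lra].
  have : rho * g <= rho by nra.
  by nra.
- rewrite mulrAC ler_pdivrMr ?dE; [|by rewrite !mulr_gt0 //; lra].
  by nra.
- rewrite mulrAC ler_pdivrMr ?dE; [|by rewrite !mulr_gt0 //; lra].
  have : g * d%:R <= gamma * ((1 + d%:R) * (1 + rho)) by rewrite ler_pM //; nra.
  by nra.
Qed.

(** * Total flow along the product *)

Lemma stochastic_lprodmx (R : realType) (d : nat) (M : nat -> 'M[R]_d) :
  (forall n, (1 <= n)%N -> stochastic (M n)) ->
  forall n, stochastic (lprodmx M n).
Proof.
move=> hM; elim=> [|n [P0 P1]] /=.
  split=> [i j|i]; first by rewrite mxE ler0n.
  rewrite (bigD1 i) //= mxE eqxx big1 ?addr0 // => j ji.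
  by rewrite mxE eq_sym (negbTE ji).
have [M0 M1] := hM n.+1 isT; split=> [i j|i].
  by rewrite mxE sumr_ge0 // => k _; rewrite mulr_ge0.
under eq_bigr => j _ do rewrite mxE.
rewrite exchange_big -(M1 i); apply: eq_bigr => k _ /=.
by rewrite -mulr_sumr P1 mulr1.
Qed.

Lemma stochastic_le1 (R : realType) (d : nat) (A : 'M[R]_d) i j :
  stochastic A -> A i j <= 1.
Proof.
by move=> [A0 A1]; rewrite -(A1 i) (bigD1 j) //= lerDl sumr_ge0.
Qed.

Lemma total_flow_bounded (R : realType) (d : nat) (M : nat -> 'M[R]_d)
    (gamma rho : R) (gamma0 : 0 < gamma) (rho1 : 1 <= rho)
    (hM : forall n, balanced gamma rho (M n.+1)) :
  exists D : R, forall (l : 'I_d) N,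
    \sum_(n < N) flow (M n.+1) (fun i => lprodmx M n i l) <= D.
Proof.
have [w [c [w01 c0 step]]] := @weighted_sum_gain R d _ _ gamma0 rho1.
have P_stoch : forall n, stochastic (lprodmx M n).
  by apply: stochastic_lprodmx => -[//|n] _; have [] := hM n.
(* The ranking is free at time [N] and determined backwards down to time 0. *)
have telescoped (l : 'I_d) N (s : 'S_d) : exists r : 'S_d,
    \sum_i w (r i) * lprodmx M 0 i l
      + c * \sum_(n < N) flow (M n.+1) (fun i => lprodmx M n i l)
    <= \sum_i w (s i) * lprodmx M N i l.
  elim: N s => [s|N IH s]; first by exists s; rewrite big_ord0 mulr0 addr0.
  have [t ht] := step _ (hM N) (fun i => lprodmx M N i l) s.
  have [r hr] := IH t; exists r.
  rewrite big_ord_recr /= mulrDr addrA.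
  under [leRHS]eq_bigr => i _ do rewrite mxE.
  by apply: le_trans ht; rewrite lerD2r.
exists (d%:R / c) => l N; have [r hr] := telescoped l N 1%g.
rewrite ler_pdivlMr // mulrC.
have : 0 <= \sum_i w (r i) * lprodmx M 0 i l.
  apply: sumr_ge0 => i _; apply: mulr_ge0; last exact: (P_stoch 0%N).1.
  by have /andP[] := w01 (r i).
suff : \sum_i w ((1%g : 'S_d) i) * lprodmx M N i l <= d%:R by lra.
rewrite -[X in X%:R]card_ord -sumr_const ler_sum // => i _.
have /andP[w0 w1] := w01 ((1%g : 'S_d) i).
by rewrite mulr_ile1 ?stochastic_le1 //; exact: (P_stoch N).1.
Qed.

(** * Series, finite variation and limits of matrices *)

Lemma mx_norm_leP (R : realType) (m n : nat) (A : 'M[R]_(m, n)) (e : R)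
    (e0 : 0 <= e) :
  (forall i j, `|A i j| <= e) <-> `|A| <= e.
Proof.
rewrite [X in _ <-> X <= _](mx_normrE A); split=> [h|/bigmax_leP[_ h] i j].
  by apply: bigmax_le => // -[i j] _; apply: h.
exact: (h (i, j)).
Qed.

Lemma cvg_mx (R : realType) (m n : nat) (A : nat -> 'M[R]_(m, n))
    (L : 'M[R]_(m, n)) :
  (forall i j, A k i j @[k --> \oo] --> L i j) -> A k @[k --> \oo] --> L.
Proof.
move=> h; apply/cvgrPdist_le => e e0.
have : \forall k \near \oo, forall i j, `|L i j - A k i j| <= e.
  apply: filter_forall => i; apply: filter_forall => j.
  exact: (cvgr_dist_le _ _ (h i j) _ e0).
apply: filterS => k hk; apply/mx_norm_leP => [|i j]; first exact: ltW.
by rewrite !mxE.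
Qed.

Lemma stochastic_cvg (R : realType) (d : nat) (A : nat -> 'M[R]_d)
    (L : 'M[R]_d) :
  (forall n, stochastic (A n)) ->
  (forall i j, A n i j @[n --> \oo] --> L i j) -> stochastic L.
Proof.
move=> hA hL; split=> [i j|i].
  apply: (closed_cvg _ (@closed_ge R 0) _ _ (hL i j)).
  by apply: nearW => n; exact: (hA n).1.
have : \sum_j A n i j @[n --> \oo] --> \sum_j L i j.
  by apply: cvg_big => //; exact: add_continuous.
have -> : (fun n => \sum_j A n i j) = cst 1.
  by apply/funext => n; rewrite (hA n).2.
move=> h; apply: (cvg_unique (@norm_hausdorff _ _) h); exact: cvg_cst.
Qed.

Lemma is_cvg_series_shift (R : realType) (V : normedModType R) (u : nat -> V) :
  cvgn (series (fun n => u n.+1)) = cvgn (series u).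
Proof.
have E : (fun n => series u n.+1) = cst (u 0%N) + series (fun n => u n.+1).
  by apply/funext => n; rewrite seriesEnat /= big_nat_recl // seriesEnat.
have -> : cvgn (series u) = cvgn (fun n => series u n.+1).
  apply/propext; split => /cvg_ex[l hl]; apply/cvg_ex; exists l.
    by rewrite cvg_shiftS.
  by rewrite -cvg_shiftS.
by rewrite E is_cvgDrE //; apply: is_cvg_cst.
Qed.

Lemma nneg_series_cvg (R : realType) (u : nat -> R) (D : R) :
  (forall n, 0 <= u n) -> (forall n, \sum_(k < n) u k <= D) -> cvgn (series u).
Proof.
move=> u0 uD; apply: nondecreasing_is_cvgn.
  by apply: nondecreasing_series => n _ _.
by exists D => _ [n _ <-]; rewrite seriesEord uD.
Qed.

Lemma near_series_le_cvg (R : realType) (u v : nat -> R) :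
  (\forall n \near \oo, 0 <= u n <= v n) -> cvgn (series v) -> cvgn (series u).
Proof.
move=> [N _ uv] cv.
pose trunc (w : nat -> R) n := if (N <= n)%N then w n else 0.
have truncE w : cvgn (series w) = cvgn (series (trunc w)).
  rewrite -(is_cvg_series_restrict N w) -(is_cvg_series_restrict N (trunc w)).
  suff -> : (fun n => \sum_(N <= k < n) w k)
          = (fun n => \sum_(N <= k < n) trunc w k) by [].
  by apply/funext => n; apply: eq_big_nat => k /andP[Nk _]; rewrite /trunc Nk.
rewrite truncE; rewrite truncE in cv.
apply: (series_le_cvg _ _ _ cv) => n; rewrite /trunc; case: ifP => // Nn;
  have /andP[? ?] := uv n Nn => //.
by apply: le_trans; eassumption.
Qed.

Lemma finite_variation_cvg (R : realType) (V : completeNormedModType R)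
    (x : nat -> V) :
  finite_variation x -> cvgn x.
Proof.
move=> /normed_cvg; rewrite telescopeK /= => /cvg_ex[l hl].
apply/cvg_ex; exists (l + x 0%N).
have xE : (fun n => x n - x 0%N) + cst (x 0%N) = x.
  by apply/funext => n; exact: subrK.
have : ((fun n => x n - x 0%N) + cst (x 0%N)) n @[n --> \oo] --> l + x 0%N.
  by apply: cvgD; [exact: hl | exact: cvg_cst].
by rewrite xE.
Qed.

(** * Convergence of the products *)

(** The row sums being 1, the increment of an entry is an average of
    differences:
    [(M x - x) i = \sum_j M i j * (x j - x i)]. *)
Lemma dist_lprodmx_le_flow (R : realType) (d : nat) (M : nat -> 'M[R]_d) n :
  stochastic (M n.+1) ->
  `|lprodmx M n.+1 - lprodmx M n|
    <= \sum_l flow (M n.+1) (fun i => lprodmx M n i l).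
Proof.
move=> [M0 M1].
apply/mx_norm_leP => [|i l]; first by rewrite sumr_ge0 // => l _; exact: flow_ge0.
rewrite (bigD1 l) //= -[leLHS]addr0 lerD //; last first.
  by rewrite sumr_ge0 // => k _; exact: flow_ge0.
apply: le_trans (row_flow_le _ i M0).
have -> : (M n.+1 *m lprodmx M n - lprodmx M n) i l
    = \sum_j M n.+1 i j * (lprodmx M n j l - lprodmx M n i l).
  rewrite !mxE -{1}[lprodmx M n i l]mul1r -(M1 i) mulr_suml -sumrB.
  by apply: eq_bigr => j _; rewrite mulrBr.
apply: le_trans (ler_norm_sum _ _ _) _; apply: ler_sum => j _.
by rewrite normrM ger0_norm // distrC.
Qed.

Theorem theorem7 (R : realType) (d : nat) (M : nat -> 'M[R]_d)
    (gamma rho : R)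
    (hM : forall n, (1 <= n)%N -> stochastic (M n))
    (hgamma : 0 < gamma) (hrho : 1 <= rho)
    (hdiag : forall n (i : 'I_d), (1 <= n)%N -> gamma <= M n i i)
    (hrev : forall n (i j : 'I_d), (1 <= n)%N -> M n i j <= rho * M n j i) :
  finite_variation (fun n => lprodmx M n.+1) /\
  exists L : 'M[R]_d,
    [/\ stochastic L,
        lprodmx M n.+1 @[n --> \oo] --> L
      & forall i j : 'I_d, row i L <> row j L ->
          cvgn (fun n => \sum_(1 <= k < n) M k i j) /\
          cvgn (fun n => \sum_(1 <= k < n) M k j i)].
Proof.
have balM n : balanced gamma rho (M n.+1).
  by split=> [|i|i j]; [exact: hM | exact: hdiag | exact: hrev].
have P_stoch n : stochastic (lprodmx M n) by exact: stochastic_lprodmx.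
have M0 n i j : 0 <= M n.+1 i j by exact: (hM n.+1 isT).1.
have [D flowD] := total_flow_bounded hgamma hrho balM.
(* [u n] is indexed by the matrix [M n] that produces the flow; [u 0] is a
   meaningless value, harmless for convergence. *)
pose u n := \sum_l flow (M n) (fun i => lprodmx M n.-1 i l).
have u_ge0 n : 0 <= u n.+1 by rewrite sumr_ge0 // => l _; exact: flow_ge0.
have u_cvg : cvgn (series u).
  rewrite -is_cvg_series_shift.
  apply: (@nneg_series_cvg _ _ (\sum_(l < d) D)) => // n.
  by rewrite exchange_big; apply: ler_sum => l _; exact: flowD.
have var : finite_variation (fun n => lprodmx M n.+1).
  rewrite /finite_variation.
  rewrite (is_cvg_series_shift (fun n => `|lprodmx M n.+1 - lprodmx M n|)).
  move: u_cvg; rewrite -(is_cvg_series_shift u); apply: series_le_cvg => n //.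
  by apply: dist_lprodmx_le_flow; exact: hM.
split=> //.
have entry_cvg i j : cvgn (fun n => lprodmx M n.+1 i j).
  apply: finite_variation_cvg; move: var; apply: series_le_cvg => n //.
  have /mx_norm_leP : `|lprodmx M n.+2 - lprodmx M n.+1|
      <= `|lprodmx M n.+2 - lprodmx M n.+1| by [].
  by move=> /(_ (normr_ge0 _) i j); rewrite [X in `|X|]mxE [X in _ + X]mxE.
pose L : 'M[R]_d := \matrix_(i, j) limn (fun n => lprodmx M n.+1 i j).
have entry_lim i j : lprodmx M n.+1 i j @[n --> \oo] --> L i j.
  by rewrite mxE; exact: entry_cvg.
exists L; split.
- by apply: stochastic_cvg entry_lim.
- exact: cvg_mx.
move=> i j rowij.
have [l Lij] : exists l, L i l != L j l.
  apply: contra_notP rowij => /forallNP Lij; apply/rowP => l; rewrite !mxE.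
  by move: (Lij l) => /negP; rewrite negbK !mxE => /eqP.
wlog suff : i j {rowij} Lij / cvgn (fun n => \sum_(1 <= k < n) M k i j).
  by move=> h; split; apply: h => //; rewrite eq_sym.
rewrite is_cvg_series_restrict.
(* Eventually the entries [i] and [j] of the column [l] stay [delta] apart, so
   that [M n i j * delta] is at most the flow. *)
pose delta := `|L i l - L j l| / 2.
have delta0 : 0 < delta by rewrite divr_gt0 // normr_gt0 subr_eq0.
have cv : cvgn (series (fun n => delta^-1 * u n)) by exact: is_cvg_seriesZ.
apply: (near_series_le_cvg _ cv).
have gap : `|lprodmx M n.+1 i l - lprodmx M n.+1 j l| @[n --> \oo]
    --> `|L i l - L j l|.
  by apply: cvg_norm; apply: cvgB; exact: entry_lim.
have [|N _ hN] := cvgr_ge _ gap delta.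
  by rewrite /delta ltr_pdivrMr // mulr_natr mulr2n ltrDl normr_gt0 subr_eq0.
exists N.+2 => // -[//|[//|n]] /= Nn.
rewrite M0 /= mulrC ler_pdivlMr //.
apply: le_trans
  (_ : M n.+2 i j * `|lprodmx M n.+1 i l - lprodmx M n.+1 j l| <= _).
  by rewrite ler_wpM2l // hN.
rewrite /u (bigD1 l) //= -[leLHS]addr0 lerD //; last first.
  by rewrite sumr_ge0 // => k _; exact: flow_ge0.
apply: le_trans (row_flow_le _ i (M0 n.+1)).
by rewrite (bigD1 j) //= lerDl sumr_ge0 // => b _; rewrite mulr_ge0.
Qed.
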